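(* Let $N=\{1,\dots,n\}$ be a set of $n\ge1$ agents and $M$ a finite set of indivisible goods. There exists a truthful mechanism $\mathcal{X}$, defined on all profiles $\boldsymbol v=(v_1,\dots,v_n)$ of normalized, monotone, subadditive leveled valuations on $M$, such that for every such profile the allocation $\mathcal{X}(\boldsymbol v)$ is $\frac12$-MMS.
   Context: A valuation $v:2^M\to\mathbb{R}_{\ge0}$ is normalized if $v(\emptyset)=0$, monotone if $v(S)\le v(T)$ whenever $S\subseteq T$, subadditive if $v(S)+v(T)\ge v(S\cup T)$ for all $S,T\subseteq M$, and leveled if $v(S)>v(T)$ whenever $|S|>|T|$. $\Pi_n(M)$ is the set of all tuples $(A_1,\dots,A_n)$ of pairwise disjoint (possibly empty) subsets of $M$ whose union is $M$ (allocations). A mechanism (deterministic, without payments) is a map $\mathcal{X}$ from valuation profiles in the given domain to $\Pi_n(M)$; $\mathcal{X}_i(\boldsymbol v)$ is agent $i$'s bundle. It is truthful if $v_i(\mathcal{X}_i(\boldsymbol v))\ge v_i(\mathcal{X}_i(v_i',v_{-i}))$ for every profile $\boldsymbol v$, agent $i$, and valuation $v_i'$ in the domain. An allocation $A$ is $\alpha$-MMS if $v_i(A_i)\ge\alpha\,\mu_i^n(M)$ for all $i$, where $\mu_i^n(M)=\max_{A\in\Pi_n(M)}\min_{l\in\{1,\dots,n\}}v_i(A_l)$. *)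

(* Defs.v *)
From HB Require Import structures.
From mathcomp Require Import all_boot all_order all_algebra.
From mathcomp Require Import reals.

Set Implicit Arguments.
Unset Strict Implicit.
Unset Printing Implicit Defensive.

Import Order.TTheory GRing.Theory Num.Theory.
Local Open Scope ring_scope.

Section Valuations.
Variables (R : realType) (M : finType).

(* Nonnegativity is a separate condition, part of [subadditive_leveled]. *)
Definition valuation := {set M} -> R.

Implicit Type v : valuation.

Definition nonnegative_val v := forall S : {set M}, 0 <= v S.

Definition normalized v := v set0 = 0.

Definition monotone_val v := forall S T : {set M}, S \subset T -> v S <= v T.

Definition subadditive_val v := forall S T : {set M}, v (S :|: T) <= v S + v T.

Definition leveled v := forall S T : {set M}, (#|T| < #|S|)%N -> v T < v S.

Definition subadditive_leveled v :=
  [/\ nonnegative_val v, normalized v, monotone_val v,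
      subadditive_val v & leveled v].

End Valuations.

Section Allocations.
Variables (n : nat) (M : finType).

Definition is_allocation (A : {ffun 'I_n -> {set M}}) : bool :=
  [forall i, forall j, (i != j) ==> [disjoint A i & A j]]
  && (\bigcup_i A i == [set: M]).

Definition allocation := {A : {ffun 'I_n -> {set M}} | is_allocation A}.

Definition bundle (A : allocation) (i : 'I_n) : {set M} := val A i.

End Allocations.

Section Mechanisms.
Variables (R : realType) (n : nat) (M : finType).

(* The maximin share of agent [i] with valuation [v].  The seed [v (bundle A i)]
   is one of the values being minimized, so the inner operator is the true
   minimum over the bundles of [A]; the share depends on [i] in no other way.
   The seed [0] is harmless for the maximum because [v] is nonnegative and, as
   ['I_n] is inhabited by [i], allocations exist. *)
Definition mms (i : 'I_n) (v : valuation R M) : R :=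
  \big[Order.max/0]_(A : allocation n M)
    \big[Order.min/v (bundle A i)]_(l < n) v (bundle A l).

Definition is_mms_allocation (alpha : R) (v : 'I_n -> valuation R M)
    (A : allocation n M) :=
  forall i : 'I_n, alpha * mms i (v i) <= v i (bundle A i).

Variable D : valuation R M -> Prop.

Definition profile := 'I_n -> {v : valuation R M | D v}.

Definition mechanism := profile -> allocation n M.

Definition truthful (X : mechanism) :=
  forall (v : profile) (i : 'I_n) (w : {v : valuation R M | D v}),
    sval (v i) (bundle (X [eta v with i |-> w]) i)
    <= sval (v i) (bundle (X v) i).

End Mechanisms.

(* Main.v *)
(** Let the agents pick in turn, agent [k] choosing her favourite [s k]-subset
    of the goods left, where [s k = floor ((m + k) / n)] and [m] is the number
    of goods; these quotas add up to [m].  Agent [k] cannot influence what is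
    left when her turn comes, so the mechanism is truthful.  Suppose every
    bundle of some allocation is worth more than twice her pick [B].  Leveledness
    forces all these bundles to have at least [s k] goods, and some bundle [C]
    has at most [s k] since [m < n * (s k + 1)].  If [s k >= 2], write [C] as a
    good plus the rest: both parts are smaller than [B], so subadditivity gives
    [v C <= 2 v B].  If [s k = 0], [C] is empty.  If [s k = 1], at most [k]
    goods are gone, and every singleton bundle is among them (otherwise she
    could have picked it); counting gives [2 n <= m + k], against [s k = 1]. *)
Require Import Defs.
From HB Require Import structures.
From mathcomp Require Import all_boot all_order all_algebra.
From mathcomp Require Import reals.
From mathcomp Require Import lra.

Set Implicit Arguments.
Unset Strict Implicit.
Unset Printing Implicit Defensive.

Import Order.TTheory GRing.Theory Num.Theory.
Local Open Scope ring_scope.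

(* Hermite's identity *)
Lemma sum_divn_shift (m n : nat) :
  (0 < n)%N -> (\sum_(k < n) (m + k) %/ n = m)%N.
Proof.
case: n => // n _; elim: m => [|m IHm].
  by rewrite big1 // => k _; rewrite add0n divn_small.
(* Passing from [m] to [m.+1] shifts the window of numerators by one: the term that enters at the
   top is the dropped bottom term plus exactly 1. *)
rewrite big_ord_recr /= addSnnS divnDr // divnn addn1 addnS -[in RHS]IHm.
rewrite [in RHS]big_ord_recl /= addn0 addnC; congr _.+1; congr (_ + _)%N.
by apply: eq_bigr => k _; rewrite /bump /= addSnnS.
Qed.

Section Picking.
Variables (R : realType) (M : finType).
Implicit Types (u : nat -> valuation R M) (T S : {set M}).

(** An arbitrary witness, there only to seed the arg max in [favourite]. *)
Definition initial_subset T s : {set M} := [set x in take s (enum T)].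

Lemma initial_subsetP T s : (s <= #|T|)%N ->
  (initial_subset T s \subset T) && (#|initial_subset T s| == s).
Proof.
move=> sT; apply/andP; split.
  by apply/subsetP=> x; rewrite inE => /mem_take; rewrite mem_enum.
have /card_uniqP : uniq (take s (enum T)) by rewrite take_uniq ?enum_uniq.
by rewrite cardsE => ->; rewrite size_takel // -cardE.
Qed.

Definition favourite (w : valuation R M) T s : {set M} :=
  [arg max_(S > initial_subset T s | (S \subset T) && (#|S| == s)) w S]%O.

Lemma favouriteP w T s : (s <= #|T|)%N ->
  [/\ favourite w T s \subset T, #|favourite w T s| = s &
      forall S, S \subset T -> #|S| = s -> w S <= w (favourite w T s)].
Proof.
move=> /initial_subsetP init; rewrite /favourite.
case: arg_maxP => // S /andP[ST /eqP cS] maxS; split=> // S' S'T cS'.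
by apply: maxS; rewrite S'T cS' eqxx.
Qed.

Variable s : nat -> nat.

Fixpoint goods_left u k : {set M} :=
  if k is j.+1 then goods_left u j :\: favourite (u j) (goods_left u j) (s j)
  else setT.

Definition pick u k := favourite (u k) (goods_left u k) (s k).

(** The source of truthfulness: the bound on [j] is strict, so the report of agent [k] does not
    affect what she is offered. *)
Lemma goods_left_eq u u' k :
  (forall j, (j < k)%N -> u j = u' j) -> goods_left u k = goods_left u' k.
Proof.
elim: k => //= k IHk uu'; rewrite uu' // IHk // => j /ltnW jk.
exact: uu'.
Qed.

Lemma goods_left_anti u j k : (j <= k)%N -> goods_left u k \subset goods_left u j.
Proof.
elim: k => [|k IHk]; first by rewrite leqn0 => /eqP->.
rewrite leq_eqVlt => /predU1P[->//|/IHk]; exact/subset_trans/subsetDl.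
Qed.

Section Quotas.
Variable n : nat.
Hypothesis sum_s : (\sum_(k < n) s k = #|M|)%N.

Lemma card_goods_leftD u k :
  (k <= n)%N -> (#|goods_left u k| + \sum_(j < k) s j)%N = #|M|.
Proof.
elim: k => [|k IHk] kn; first by rewrite big_ord0 addn0 cardsT.
have {}IHk := IHk (ltnW kn).
(* The quota can be met because the first [k.+1] quotas add up to at most [#|M|]. *)
have sk : (s k <= #|goods_left u k|)%N.
  rewrite -(leq_add2r (\sum_(j < k) s j)) IHk -sum_s addnC.
  rewrite -!(big_mkord xpredT s) -big_nat_recr //=.
  by rewrite [leqRHS](@big_cat_nat _ _ _ k.+1) //= leq_addr.
have [sub card_f _] := favouriteP (u k) sk.
by rewrite big_ord_recr /= cardsD (setIidPr sub) card_f addnA addnAC subnK.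
Qed.

Lemma leq_quota u k : (k < n)%N -> (s k <= #|goods_left u k|)%N.
Proof.
move=> kn; have := card_goods_leftD u kn; rewrite -(card_goods_leftD u (ltnW kn)).
rewrite big_ord_recr /= addnA addnAC => /eqP; rewrite eqn_add2r => /eqP <-.
exact: leq_addl.
Qed.

Lemma pick_subset u k : (k < n)%N -> pick u k \subset goods_left u k.
Proof. by move=> /(leq_quota u)/(favouriteP (u k))[]. Qed.

Lemma card_pick u k : (k < n)%N -> #|pick u k| = s k.
Proof. by move=> /(leq_quota u)/(favouriteP (u k))[]. Qed.

Lemma pick_max u k S : (k < n)%N -> S \subset goods_left u k -> #|S| = s k ->
  u k S <= u k (pick u k).
Proof. by move=> /(leq_quota u)/(favouriteP (u k))[_ _]; apply. Qed.

Lemma pick_disjoint u j k : (j < k < n)%N -> [disjoint pick u j & pick u k].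
Proof.
move=> /andP[jk kn]; rewrite disjoint_sym.
apply: (disjointWl (subset_trans (pick_subset u kn) (goods_left_anti u jk))).
by rewrite /= -setI_eq0 setIC setDE setICA setICr setI0.
Qed.

Lemma pick_allocation u : is_allocation [ffun i : 'I_n => pick u i].
Proof.
have dis (i j : 'I_n) : i != j -> [disjoint pick u i & pick u j].
  case: (ltngtP i j) => [ij|ji|/val_inj->]; last by rewrite eqxx.
    by rewrite pick_disjoint // ij ltn_ord.
  by rewrite disjoint_sym pick_disjoint // ji ltn_ord.
apply/andP; split.
  by apply/forallP=> i; apply/forallP=> j; apply/implyP; rewrite !ffunE; apply: dis.
under eq_bigr do rewrite ffunE.
have left_cover k : (k <= n)%N ->
    ~: goods_left u k \subset \bigcup_(i < n) pick u i.
  elim: k => [|k IHk] kn /=; first by rewrite setCT sub0set.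
  rewrite setCD subUset IHk ?(ltnW kn) //=.
  exact: (bigcup_sup (Ordinal kn)).
have := left_cover n (leqnn n).
suff -> : goods_left u n = set0 by rewrite setC0 subTset.
apply/eqP; rewrite -cards_eq0 -(eqn_add2r (\sum_(j < n) s j)).
by rewrite card_goods_leftD // sum_s.
Qed.

End Quotas.
End Picking.

(** The bundles cut [T] into disjoint pieces. This serves both for [T] the full set and for [T] the
    goods already taken. *)
Lemma sum_card_allocation (n : nat) (M : finType) (A : allocation n M) (T : {set M}) :
  (\sum_(l < n) #|bundle A l :&: T| = #|T|)%N.
Proof.
have /andP[/forallP dis /eqP cov] := valP A.
rewrite -[in RHS](setTI T) -cov big_distrl /=.
under eq_bigr do rewrite -sum1_card.
rewrite -sum1_card partition_disjoint_bigcup //= => i j ij.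
have /forallP/(_ j)/implyP/(_ ij) := dis i.
exact: disjointW (subsetIl _ _) (subsetIl _ _).
Qed.

(** The bound [0 <= c] takes care of the seed [0] of the maximum. *)
Lemma mms_le (R : realType) (n : nat) (M : finType) (i : 'I_n)
    (v : valuation R M) (c : R) : 0 <= c ->
  (forall A : allocation n M, exists l, v (bundle A l) <= c) -> mms i v <= c.
Proof.
move=> c0 hA; apply: bigmax_le => // A _; have [l vl] := hA A.
exact: bigmin_inf vl.
Qed.

Theorem proposition5p2 (R : realType) (n : nat) (M : finType) (hn : (0 < n)%N) :
  exists X : mechanism n (@subadditive_leveled R M),
    truthful X /\
    forall v : profile n (@subadditive_leveled R M),
      is_mms_allocation (1 / 2%:R) (fun i => sval (v i)) (X v).
Proof.
pose s k := ((#|M| + k) %/ n)%N.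
have sum_s : (\sum_(k < n) s k = #|M|)%N by exact: sum_divn_shift.
pose D := @subadditive_leveled R M.
(* Turns are numbered by [nat]; the zero valuation is a filler for turns from [n] on, which never
   influence the picks of actual agents. *)
pose ext (v : profile n D) (k : nat) : valuation R M :=
  if insub k is Some i then sval (v i) else fun=> 0.
have extE v (i : 'I_n) : ext v i = sval (v i) by rewrite /ext valK.
pose X : mechanism n D := fun v =>
  Sub [ffun i : 'I_n => pick s (ext v) i] (pick_allocation sum_s (ext v)).
have XE v i : bundle (X v) i = pick s (ext v) i by rewrite /bundle /= ffunE.
exists X; split=> [v i w|v i].
  rewrite !XE -extE; set v' := [eta v with i |-> w].
  have left_eq : goods_left s (ext v') i = goods_left s (ext v) i.
    apply: goods_left_eq => j ji.
    rewrite -[j]/(val (Ordinal (ltn_trans ji (ltn_ord i)))) !extE /v' /=.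
    by rewrite -val_eqE /= ltn_eqF.
  (* The pick after a deviation has the same size and comes from the same goods, so the truthful
     pick was chosen over it. *)
  apply: (pick_max sum_s) => //; last exact: (card_pick sum_s).
  by rewrite -left_eq; apply: (pick_subset sum_s).
rewrite XE.
have := pick_max sum_s (u := ext v) (ltn_ord i).
have := card_pick sum_s (ext v) (ltn_ord i).
rewrite extE; case: (v i) => /= w [w_ge0 w0 _ w_sub w_lev].
set B := pick _ _ _ => cB maxB.
have wB := w_ge0 B.
suff : mms i w <= 2 * w B by lra.
apply: mms_le => [|A]; first by lra.
case: (boolP [exists l, w (bundle A l) <= 2 * w B]) => [/existsP//|].
rewrite negb_exists => /forallP big; exfalso.
have {}big l : 2 * w B < w (bundle A l) by rewrite ltNge.
have card_ge l : (s i <= #|bundle A l|)%N.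
  by rewrite leqNgt -cB; apply/negP => /w_lev; have := big l; lra.
have sumA : (\sum_(l < n) #|bundle A l| = #|M|)%N.
  by rewrite -cardsT -(sum_card_allocation A); under [RHS]eq_bigr do rewrite setIT.
have mi_lt : (#|M| + i < (s i).+1 * n)%N by rewrite -ltn_divLR.
have [l card_le] : exists l, (#|bundle A l| <= s i)%N.
  apply/existsP; apply: contraLR mi_lt.
  rewrite negb_exists -leqNgt => /forallP card_gt.
  apply: leq_trans (leq_addr _ _); rewrite -sumA mulnC -[X in (X * _)%N]card_ord.
  by rewrite -sum_nat_const; apply: leq_sum => l _; rewrite ltnNge.
have cl : #|bundle A l| = s i by apply/eqP; rewrite eqn_leq card_le card_ge.
case: (ltngtP (s i) 1) => [s0|s2|s1].
- move: cl s0 => <-; rewrite ltnS leqn0 cards_eq0 => /eqP l0.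
  by have := big l; rewrite l0 w0; lra.
- have /card_gt0P[x xl] : (0 < #|bundle A l|)%N by rewrite cl ltnW.
  have wx : w [set x] < w B by apply: w_lev; rewrite cards1 cB.
  have wl : w (bundle A l :\ x) < w B.
    by apply: w_lev; rewrite cB -cl [in ltnRHS](cardsD1 x) xl.
  by have := w_sub [set x] (bundle A l :\ x); rewrite setD1K //; have := big l; lra.
- pose gone := ~: goods_left s (ext v) i.
  have gone_le : (#|gone| <= i)%N.
    (* Quotas do not decrease with the index, so each earlier agent took at most [s i = 1] good. *)
    have sle : (\sum_(j < i) s j <= i)%N.
      rewrite -[leqRHS]card_ord -sum1_card; apply: leq_sum => j _.
      by rewrite -s1 leq_div2r // leq_add2l ltnW.
    apply: leq_trans sle; rewrite -(leq_add2l #|goods_left s (ext v) i|).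
    by rewrite (card_goods_leftD sum_s) ?cardsC // ltnW.
  (* A bundle has two goods, or its only good is gone and is counted twice. Summing over the bundles
     gives [2 * n <= #|M| + #|gone|]. *)
  have two l' : (2 <= #|bundle A l'| + #|bundle A l' :&: gone|)%N.
    have := card_ge l'; rewrite s1 leq_eqVlt => /predU1P[c1|]; last first.
      by move=> c2; apply: leq_trans c2 (leq_addr _ _).
    rewrite -c1 ltnS card_gt0; apply/negP; rewrite setI_eq0 disjoints_subset setCK.
    by move=> /maxB; rewrite s1 -c1 => /(_ erefl); have := big l'; lra.
  move: mi_lt; rewrite s1 ltnNge => /negP; apply.
  apply: leq_trans (leq_add (leqnn _) gone_le).
  rewrite -sumA -(sum_card_allocation A gone) -big_split /= mulnC.
  rewrite -[X in (X * _)%N]card_ord -sum_nat_const.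
  exact: leq_sum.
Qed.
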